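(* Let $(M,g)$ be a Riemannian manifold of dimension $m$ and let $G$ be a nondegenerate $g$-natural metric on $TM$ defined by functions $\alpha_i,\beta_i$, $i=1,2,3$. Let $(U;x_i,\ i=1,\dots,m)$ be a normal coordinate system of $(M,g)$ centred at a point $p\in M$, and write the matrix of $G^{-1}$ relative to the local frame $(\partial_{x_i}^h,\partial_{x_i}^v)_{i=1,\dots,m}$ on $\pi^{-1}(U)$ in block form $$G^{-1}\equiv\begin{pmatrix}\Lambda&\Theta\\ \Theta&\Omega\end{pmatrix},\qquad \Lambda=(\lambda^{ij}),\ \Theta=(\theta^{ij}),\ \Omega=(\omega^{ij}),\quad 1\le i,j\le m .$$ Then for any $(x,u)\in\pi^{-1}(U)$ with $u=\sum_{i=1}^m u^i\partial_{x_i}\in T_xM$, $$\lambda^{ij}(x,u)=\frac{\alpha_1}{\alpha}g^{ij}-\psi_\lambda u^iu^j,\qquad \theta^{ij}(x,u)=-\frac{\alpha_2}{\alpha}g^{ij}-\psi_\theta u^iu^j,\qquad \omega^{ij}(x,u)=\frac{\alpha_1+\alpha_3}{\alpha}g^{ij}-\psi_\omega u^iu^j,$$ where $(g^{ij})$ is the inverse of the matrix $(g_{ij})$, $g_{ij}=g(\partial_{x_i},\partial_{x_j})$, and all functions $\alpha_i,\alpha,\psi_\lambda,\psi_\theta,\psi_\omega$ are evaluated at $t=g_x(u,u)$.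
   Context: $\mathbb{R}^+=[0,\infty)$; $\partial_{x_i}=\partial/\partial x_i$. Let $\nabla$ be the Levi-Civita connection of $(M,g)$ and $\pi:TM\to M$ the projection. The tangent space splits as $T_{(x,u)}TM=H_{(x,u)}M\oplus V_{(x,u)}M$ into horizontal (with respect to $\nabla$) and vertical subspaces. For $X\in T_xM$, the horizontal lift $X^h\in H_{(x,u)}M$ is the unique horizontal vector with $\pi_*X^h=X$, and the vertical lift $X^v\in V_{(x,u)}M$ is the vertical vector with $X^v(df)=X(f)$ for all functions $f$ on $M$, where $df$ is viewed as the function $(x,u)\mapsto u(f)$ on $TM$. A $g$-natural metric $G$ on $TM$ is a symmetric $(0,2)$-tensor field on $TM$ obtained from $g$ by a first order natural operator; equivalently, it is given by smooth functions $\alpha_i,\beta_i:\mathbb{R}^+\to\mathbb{R}$, $i=1,2,3$ (with $\beta_i=0$ if $\dim M=1$), such that for all $x\in M$ and $u,X,Y\in T_xM$, with $t=g_x(u,u)$, $$G_{(x,u)}(X^h,Y^h)=(\alpha_1+\alpha_3)(t)g_x(X,Y)+(\beta_1+\beta_3)(t)g_x(X,u)g_x(Y,u),$$ $$G_{(x,u)}(X^h,Y^v)=G_{(x,u)}(X^v,Y^h)=\alpha_2(t)g_x(X,Y)+\beta_2(t)g_x(X,u)g_x(Y,u),$$ $$G_{(x,u)}(X^v,Y^v)=\alpha_1(t)g_x(X,Y)+\beta_1(t)g_x(X,u)g_x(Y,u).$$ Notation: $\phi_i(t)=\alpha_i(t)+t\beta_i(t)$, $\alpha(t)=\alpha_1(t)(\alpha_1+\alpha_3)(t)-\alpha_2(t)^2$,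 $\phi(t)=\phi_1(t)(\phi_1+\phi_3)(t)-\phi_2(t)^2$. $G$ is nondegenerate if and only if $\alpha(t)\phi(t)\neq0$ for all $t\in\mathbb{R}^+$ (known fact). Further, $$\psi_\lambda=\frac{\alpha_1[(\beta_1+\beta_3)\phi_1-\beta_2\phi_2]-\alpha_2(\alpha_1\beta_2-\alpha_2\beta_1)}{\alpha\phi},$$ $$\psi_\theta=\frac{-\alpha_2[(\beta_1+\beta_3)\phi_1-\beta_2\phi_2]+(\alpha_1+\alpha_3)(\alpha_1\beta_2-\alpha_2\beta_1)}{\alpha\phi},$$ $$\psi_\omega=\frac{(\alpha_1+\alpha_3)[\beta_1(\phi_1+\phi_3)-\beta_2\phi_2]+\alpha_2[\alpha_2(\beta_1+\beta_3)-\beta_2(\alpha_1+\alpha_3)]}{\alpha\phi}.$$ The matrix of $G$ in the frame $(\partial_{x_i}^h,\partial_{x_i}^v)$ is the $2m\times2m$ matrix with blocks $G(\partial_{x_i}^h,\partial_{x_j}^h)$, $G(\partial_{x_i}^h,\partial_{x_j}^v)$, $G(\partial_{x_i}^v,\partial_{x_j}^h)$, $G(\partial_{x_i}^v,\partial_{x_j}^v)$, and $G^{-1}$ denotes its inverse matrix. *)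

(* Defs.v *)
(* The normed space of row vectors (rV[R]_m) plays the role of R^m. *)
From HB Require Import structures.
From mathcomp Require Export all_boot all_order all_algebra.
From mathcomp Require Export all_classical all_reals all_analysis.

Set Implicit Arguments.
Unset Strict Implicit.
Unset Printing Implicit Defensive.
Export Order.TTheory GRing.Theory Num.Theory.
Export numFieldNormedType.Exports.
Local Open Scope classical_set_scope.
Local Open Scope ring_scope.

(* [Ck k D f]: f is of class C^k on D.  Meaningful for open D, since f is
   differentiated as a function on the whole space. *)
Fixpoint Ck (R : realType) (V W : normedModType R) (k : nat) (D : set V)
    (f : V -> W) {struct k} : Prop :=
  match k with
  | 0 => forall x, D x -> {for x, continuous f}
  | k'.+1 => (forall x, D x -> differentiable f x) /\
             (forall v, Ck k' D (fun x => 'D_v f x))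
  end.

Definition smooth_on (R : realType) (V W : normedModType R) (D : set V)
  (f : V -> W) : Prop := forall k, Ck k D f.

(* Smoothness on R^+ = [0, +oo[, which is not open, means being the
   restriction of a smooth function.  Only the values on [0, +oo[ matter. *)
Definition smooth_Rplus (R : realType) (a : R -> R) : Prop :=
  exists2 F : R^o -> R^o, smooth_on setT F & forall t, 0 <= t -> F t = a t.

(* A chart of a set N: [fwd] is relevant on [dom] only, its inverse [bwd]
   on the image of [dom] only. *)
Record chart (R : realType) (m : nat) (N : Type) := Chart {
  dom : set N;
  fwd : N -> 'rV[R]_m;
  bwd : 'rV[R]_m -> N }.

HB.instance Definition _ (R : realType) (m : nat) (N : Type) :=
  gen_eqMixin (chart R m N).
HB.instance Definition _ (R : realType) (m : nat) (N : Type) :=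
  gen_choiceMixin (chart R m N).

Definition cod (R : realType) (m : nat) (N : Type) (c : chart R m N) :
  set 'rV[R]_m := fwd c @` dom c.

Definition is_chart (R : realType) (m : nat) (M : topologicalType)
    (c : chart R m M) : Prop :=
  [/\ open (dom c), open (cod c),
      forall x, dom c x -> bwd c (fwd c x) = x,
      forall x, dom c x -> {for x, continuous (fwd c)} &
      forall v, cod c v -> {for v, continuous (bwd c)}].

Definition compatible (R : realType) (m : nat) (N : Type)
    (c d : chart R m N) : Prop :=
  smooth_on (fwd c @` (dom c `&` dom d)) (fwd d \o bwd c) /\
  smooth_on (fwd d @` (dom c `&` dom d)) (fwd c \o bwd d).

(* Smooth structure: a maximal smooth atlas on a Hausdorff second countable
   space; its members are all the smooth coordinate systems of M. *)
Record smooth_manifold (R : realType) (m : nat) (M : topologicalType)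
    (A : set (chart R m M)) : Prop := {
  _ : hausdorff_space M;
  _ : @second_countable M;
  _ : forall c, A c -> is_chart c;
  _ : forall x, exists2 c, A c & dom c x;
  _ : forall c d, A c -> A d -> compatible c d;
  _ : forall c, is_chart c -> (forall d, A d -> compatible c d) -> A c }.

(* Tangent vectors are families of components, one row vector per chart. *)
Definition tvec (R : realType) (m : nat) (N : Type) : Type :=
  chart R m N -> 'rV[R]_m.

Definition chart_at (R : realType) (m : nat) (N : Type)
    (A : set (chart R m N)) (x : N) : chart R m N :=
  xget (Chart set0 (fun=> 0) (fun=> x)) [set c | A c /\ dom c x].

(* The tangent space T_xN, as a linear subspace of [tvec]: components obey
   the usual transformation law.  Those in irrelevant charts are set to 0, so
   that equality of tangent vectors is Leibniz equality. *)
Definition tangent (R : realType) (m : nat) (N : Type)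
    (A : set (chart R m N)) (x : N) : set (tvec R m N) :=
  [set X | (forall c d, A c -> dom c x -> A d -> dom d x ->
              X d = 'd (fwd d \o bwd c) (fwd c x) (X c)) /\
           (forall c, ~ (A c /\ dom c x) -> X c = 0)].

(* The tangent vector at x with components w in the chart c. *)
Definition of_coord (R : realType) (m : nat) (N : Type)
    (A : set (chart R m N)) (c : chart R m N) (x : N) (w : 'rV[R]_m) :
    tvec R m N :=
  fun d => if `[< A d /\ dom d x >]
           then 'd (fwd d \o bwd c) (fwd c x) w else 0.

Definition partial (R : realType) (m : nat) (N : Type)
    (A : set (chart R m N)) (c : chart R m N) (x : N) (i : 'I_m) :
    tvec R m N :=
  of_coord A c x (delta_mx 0 i).

(* X(f), the derivative at x of f along the tangent vector X. *)
Definition vact (R : realType) (m : nat) (N : Type)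
    (A : set (chart R m N)) (x : N) (X : tvec R m N) (f : N -> R) : R :=
  let c := chart_at A x in
  'd (f \o bwd c : 'rV[R]_m -> R^o) (fwd c x) (X c).

(* W = F_* X for a map F between manifolds and X tangent at x. *)
Definition pushes (R : realType) (m n : nat) (N P : Type)
    (A : set (chart R m N)) (B : set (chart R n P)) (F : N -> P) (x : N)
    (X : tvec R m N) (W : tvec R n P) : Prop :=
  tangent B (F x) W /\
  forall c d, A c -> dom c x -> B d -> dom d (F x) ->
    W d = 'd (fwd d \o F \o bwd c) (fwd c x) (X c).

(* W is the velocity of the curve gam at time t. *)
Definition velocity (R : realType) (m : nat) (N : Type)
    (A : set (chart R m N)) (gam : R -> N) (t : R) (W : tvec R m N) : Prop :=
  tangent A (gam t) W /\
  forall c, A c -> dom c (gam t) ->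
    [/\ \forall s \near t, dom c (gam s),
        derivable (fwd c \o gam : R^o -> 'rV[R]_m) t 1 &
        W c = 'D_1 (fwd c \o gam : R^o -> 'rV[R]_m) t].

Definition smooth_fun (R : realType) (m : nat) (N : Type)
    (A : set (chart R m N)) (V : set N) (f : N -> R) : Prop :=
  forall c, A c ->
    smooth_on (fwd c @` (dom c `&` V)) (f \o bwd c : 'rV[R]_m -> R^o).

Definition vfield (R : realType) (m : nat) (N : Type)
    (A : set (chart R m N)) (X : N -> tvec R m N) : Prop :=
  (forall x, tangent A x (X x)) /\
  forall c, A c -> smooth_on (cod c) (fun v => X (bwd c v) c).

Definition bilinear_on (R : realType) (V : lmodType R) (T : set V)
    (b : V -> V -> R) : Prop :=
  (forall a X Y Z, T X -> T Y -> T Z -> b (a *: X + Y) Z = a * b X Z + b Y Z)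
  /\
  (forall a X Y Z, T X -> T Y -> T Z -> b Z (a *: X + Y) = a * b Z X + b Z Y).

Definition symmetric_on (R : realType) (V : lmodType R) (T : set V)
    (b : V -> V -> R) : Prop :=
  forall X Y, T X -> T Y -> b X Y = b Y X.

Record riemannian_metric (R : realType) (m : nat) (N : Type)
    (A : set (chart R m N)) (g : N -> tvec R m N -> tvec R m N -> R) :
    Prop := {
  _ : forall x, bilinear_on (tangent A x) (g x);
  _ : forall x, symmetric_on (tangent A x) (g x);
  _ : forall x X, tangent A x X -> X != 0 -> 0 < g x X X;
  _ : forall c i j, A c -> smooth_on (cod c)
        (fun v => let x := bwd c v in
           g x (partial A c x i) (partial A c x j) : R^o) }.

Record levi_civita (R : realType) (m : nat) (N : Type)
    (A : set (chart R m N)) (g : N -> tvec R m N -> tvec R m N -> R)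
    (nabla : (N -> tvec R m N) -> (N -> tvec R m N) -> N -> tvec R m N) :
    Prop := {
  _ : forall X Y, vfield A X -> vfield A Y -> vfield A (nabla X Y);
  _ : forall X X' Y x, vfield A X -> vfield A X' -> vfield A Y ->
        nabla (fun y => X y + X' y) Y x = nabla X Y x + nabla X' Y x;
  _ : forall f X Y x, smooth_fun A setT f -> vfield A X -> vfield A Y ->
        nabla (fun y => f y *: X y) Y x = f x *: nabla X Y x;
  _ : forall X Y Y' x, vfield A X -> vfield A Y -> vfield A Y' ->
        nabla X (fun y => Y y + Y' y) x = nabla X Y x + nabla X Y' x;
  _ : forall f X Y x, smooth_fun A setT f -> vfield A X -> vfield A Y ->
        nabla X (fun y => f y *: Y y) x =
        vact A x (X x) f *: Y x + f x *: nabla X Y x;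
  (* torsion freeness: nabla_X Y - nabla_Y X = [X, Y], tested on functions *)
  _ : forall X Y f x, vfield A X -> vfield A Y -> smooth_fun A setT f ->
        vact A x (nabla X Y x - nabla Y X x) f =
        vact A x (X x) (fun y => vact A y (Y y) f) -
        vact A x (Y x) (fun y => vact A y (X y) f);
  (* compatibility with the metric *)
  _ : forall X Y Z x, vfield A X -> vfield A Y -> vfield A Z ->
        vact A x (X x) (fun y => g y (Y y) (Z y)) =
        g x (nabla X Y x) (Z x) + g x (Y x) (nabla X Z x) }.

(* The tangent bundle: the points (x, u) with u in T_xM, with the charts
   (x, u) |-> (x^1, .., x^m, u^1, .., u^m) induced by those of M. *)
Definition tbpoint (R : realType) (m : nat) (M : Type) : Type :=
  (M * tvec R m M)%type.

Definition TM (R : realType) (m : nat) (M : Type) (A : set (chart R m M)) :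
  set (tbpoint R m M) := [set p | tangent A p.1 p.2].

Definition tb_chart (R : realType) (m : nat) (M : Type)
    (A : set (chart R m M)) (c : chart R m M) :
    chart R (m + m) (tbpoint R m M) :=
  Chart [set p | TM A p /\ dom c p.1]
        (fun p => row_mx (fwd c p.1) (p.2 c))
        (fun v => let x := bwd c (lsubmx v) in
                  (x, of_coord A c x (rsubmx v))).

Definition tb_atlas (R : realType) (m : nat) (M : Type)
    (A : set (chart R m M)) : set (chart R (m + m) (tbpoint R m M)) :=
  tb_chart A @` A.

(* Vectors tangent to TM. *)
Definition tbvec (R : realType) (m : nat) (M : Type) : Type :=
  tvec R (m + m) (tbpoint R m M).

Definition TTM (R : realType) (m : nat) (M : Type) (A : set (chart R m M))
  (p : tbpoint R m M) : set (tbvec R m M) := tangent (tb_atlas A) p.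

(* pi_* W = X, where pi : TM -> M is the projection. *)
Definition proj_push (R : realType) (m : nat) (M : Type)
    (A : set (chart R m M)) (p : tbpoint R m M) (W : tbvec R m M)
    (X : tvec R m M) : Prop :=
  pushes (tb_atlas A) A fst p W X.

(* The horizontal subspace at p = (x, u) consists of the s_* (X x), where s is
   a vector field with s(x) = u and (nabla_X s)(x) = 0. *)
Definition horizontal (R : realType) (m : nat) (M : Type)
    (A : set (chart R m M))
    (nabla : (M -> tvec R m M) -> (M -> tvec R m M) -> M -> tvec R m M)
    (p : tbpoint R m M) (W : tbvec R m M) : Prop :=
  exists s X : M -> tvec R m M,
    [/\ vfield A s, vfield A X, s p.1 = p.2, nabla X s p.1 = 0 &
        pushes A (tb_atlas A) (fun y => (y, s y)) p.1 (X p.1) W].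

Definition vertical (R : realType) (m : nat) (M : Type)
    (A : set (chart R m M)) (p : tbpoint R m M) (W : tbvec R m M) : Prop :=
  TTM A p W /\ proj_push A p W 0.

(* W = X^h at p. *)
Definition hlift (R : realType) (m : nat) (M : Type)
    (A : set (chart R m M))
    (nabla : (M -> tvec R m M) -> (M -> tvec R m M) -> M -> tvec R m M)
    (p : tbpoint R m M) (X : tvec R m M) (W : tbvec R m M) : Prop :=
  [/\ TTM A p W, horizontal A nabla p W & proj_push A p W X].

(* W = X^v at p.  The test functions f may be defined near the base point
   only, as is usual for tangent vectors; by multiplying with a cut-off
   function this amounts to testing on smooth functions on M. *)
Definition vlift (R : realType) (m : nat) (M : topologicalType)
    (A : set (chart R m M)) (p : tbpoint R m M) (X : tvec R m M)
    (W : tbvec R m M) : Prop :=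
  vertical A p W /\
  forall (V : set M) (f : M -> R), open V -> V p.1 -> smooth_fun A V f ->
    vact (tb_atlas A) p W (fun q => vact A q.1 q.2 f) =
    vact A p.1 X f.

Definition geodesic (R : realType) (m : nat) (M : Type)
    (A : set (chart R m M))
    (nabla : (M -> tvec R m M) -> (M -> tvec R m M) -> M -> tvec R m M)
    (J : set R) (gam : R -> M) (v : R -> tvec R m M) : Prop :=
  forall t, J t -> velocity A gam t (v t) /\
    exists2 W, velocity (tb_atlas A) (fun s => (gam s, v s)) t W &
               horizontal A nabla (gam t, v t) W.

(* q = exp_p(X): q = gam(1) for a geodesic gam defined around [0, 1] with
   initial velocity X at p. *)
Definition is_exp (R : realType) (m : nat) (M : Type)
    (A : set (chart R m M))
    (nabla : (M -> tvec R m M) -> (M -> tvec R m M) -> M -> tvec R m M)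
    (p : M) (X : tvec R m M) (q : M) : Prop :=
  exists e : R, 0 < e /\ exists (gam : R -> M) (v : R -> tvec R m M),
    [/\ geodesic A nabla `](- e), (1 + e)[ gam v,
        gam 0 = p, v 0 = X & gam 1 = q].

(* (U; x_i) is the inverse of (v^i) |-> exp_p(sum_i v^i e_i) on a star-shaped
   open set, for an orthonormal basis (e_i) of T_pM. *)
Definition normal_coordinates (R : realType) (m : nat) (M : Type)
    (A : set (chart R m M)) (g : M -> tvec R m M -> tvec R m M -> R)
    (nabla : (M -> tvec R m M) -> (M -> tvec R m M) -> M -> tvec R m M)
    (p : M) (c : chart R m M) : Prop :=
  [/\ A c, dom c p, cod c 0,
      forall v (t : R), cod c v -> 0 <= t <= 1 -> cod c (t *: v) &
      exists e : 'I_m -> tvec R m M,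
        [/\ forall i, tangent A p (e i),
            forall i j, g p (e i) (e j) = (i == j)%:R &
            forall v, cod c v ->
              is_exp A nabla p (\sum_i v 0 i *: e i) (bwd c v)]].

Record coefs (R : realType) := Coefs {
  al1 : R -> R; al2 : R -> R; al3 : R -> R;
  be1 : R -> R; be2 : R -> R; be3 : R -> R }.

Section Coefficients.
Context {R : realType} (F : coefs R) (t : R).

Definition phi1 : R := al1 F t + t * be1 F t.
Definition phi2 : R := al2 F t + t * be2 F t.
Definition phi3 : R := al3 F t + t * be3 F t.
Definition al13 : R := al1 F t + al3 F t.
Definition be13 : R := be1 F t + be3 F t.
Definition phi13 : R := phi1 + phi3.
Definition alpha : R := al1 F t * al13 - al2 F t ^+ 2.
Definition phi : R := phi1 * phi13 - phi2 ^+ 2.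

Definition psi_lambda : R :=
  (al1 F t * (be13 * phi1 - be2 F t * phi2)
   - al2 F t * (al1 F t * be2 F t - al2 F t * be1 F t)) / (alpha * phi).
Definition psi_theta : R :=
  (- al2 F t * (be13 * phi1 - be2 F t * phi2)
   + al13 * (al1 F t * be2 F t - al2 F t * be1 F t)) / (alpha * phi).
Definition psi_omega : R :=
  (al13 * (be1 F t * phi13 - be2 F t * phi2)
   + al2 F t * (al2 F t * be13 - be2 F t * al13)) / (alpha * phi).

End Coefficients.

(* Smoothness of G need not be required: it follows from the formulas. *)
Record g_natural (R : realType) (m : nat) (M : topologicalType)
    (A : set (chart R m M)) (g : M -> tvec R m M -> tvec R m M -> R)
    (nabla : (M -> tvec R m M) -> (M -> tvec R m M) -> M -> tvec R m M)
    (F : coefs R)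
    (G : tbpoint R m M -> tbvec R m M -> tbvec R m M -> R) : Prop := {
  _ : [/\ smooth_Rplus (al1 F), smooth_Rplus (al2 F) & smooth_Rplus (al3 F)];
  _ : [/\ smooth_Rplus (be1 F), smooth_Rplus (be2 F) & smooth_Rplus (be3 F)];
  _ : m = 1%N -> forall t, 0 <= t ->
        [/\ be1 F t = 0, be2 F t = 0 & be3 F t = 0];
  _ : forall p, TM A p -> bilinear_on (TTM A p) (G p);
  _ : forall p, TM A p -> symmetric_on (TTM A p) (G p);
  _ : forall x u X Y Xh Xv Yh Yv,
        tangent A x u -> tangent A x X -> tangent A x Y ->
        hlift A nabla (x, u) X Xh -> vlift A (x, u) X Xv ->
        hlift A nabla (x, u) Y Yh -> vlift A (x, u) Y Yv ->
        let t := g x u u in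
        [/\ G (x, u) Xh Yh
              = al13 F t * g x X Y + be13 F t * g x X u * g x Y u,
            G (x, u) Xh Yv
              = al2 F t * g x X Y + be2 F t * g x X u * g x Y u,
            G (x, u) Xv Yh
              = al2 F t * g x X Y + be2 F t * g x X u * g x Y u &
            G (x, u) Xv Yv
              = al1 F t * g x X Y + be1 F t * g x X u * g x Y u] }.

Definition nondegenerate_tb (R : realType) (m : nat) (M : Type)
    (A : set (chart R m M))
    (G : tbpoint R m M -> tbvec R m M -> tbvec R m M -> R) : Prop :=
  forall p, TM A p -> forall W, TTM A p W ->
    (forall Z, TTM A p Z -> G p W Z = 0) -> W = 0.

(* The matrix of a bilinear form b in the frame (eh_i, ev_i). *)
Definition frame_mx (R : realType) (m : nat) (V : Type) (b : V -> V -> R)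
    (eh ev : 'I_m -> V) : 'M[R]_(m + m) :=
  block_mx (\matrix_(i, j) b (eh i) (eh j)) (\matrix_(i, j) b (eh i) (ev j))
           (\matrix_(i, j) b (ev i) (eh j)) (\matrix_(i, j) b (ev i) (ev j)).

Definition metric_mx (R : realType) (m : nat) (M : Type)
    (A : set (chart R m M)) (g : M -> tvec R m M -> tvec R m M -> R)
    (c : chart R m M) (x : M) : 'M[R]_m :=
  \matrix_(i, j) g x (partial A c x i) (partial A c x j).

(* Main.v *)
(* With S = (g_ij) and w the covector dual to u, the blocks of G have the form
   a S + b w^T w, and such matrices multiply with the c S^-1 + d u^T u by the
   scalar rule of [mul_metric_rank1], which verifies the inverse.
   The lifts of the coordinate fields form a basis of the tangent space of TM:
   the projection separates the horizontal ones and the derivatives of the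
   coordinate functions separate the vertical ones.  So nondegeneracy makes the
   matrix of G invertible, and applying it to the rows (a y, b y), with y = u
   or y orthogonal to u, gives phi <> 0 and alpha <> 0 at g(u, u).  When m = 1
   and u <> 0 there is no such orthogonal y, but then phi = alpha. *)
From HB Require Import structures.
From mathcomp Require Import ring.
Require Import Defs.

Set Implicit Arguments.
Unset Strict Implicit.
Unset Printing Implicit Defensive.
Local Open Scope classical_set_scope.
Local Open Scope ring_scope.

(** * Linear algebra: kernels of symmetric 2x2 matrices and orthogonal rows *)

Lemma sym2_kernel (K : fieldType) (p q r : K) :
  p * r - q ^+ 2 = 0 ->
  exists a b : K, [/\ (a != 0) || (b != 0), a * p + b * q = 0 & a * q + b * r = 0].
Proof.
move=> det0; have [rq0|rq_neq0] := boolP ((r == 0) && (q == 0)).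
  move: rq0 => /andP[/eqP-> /eqP->].
  by exists 0, 1; rewrite oner_neq0 orbT; split=> //; ring.
(* The first equation at (r, -q) is the determinant, and the second vanishes identically; only a
   zero second row makes this vector zero, whence the case split. *)
exists r, (- q); rewrite oppr_eq0 -negb_and rq_neq0; split=> //; last by ring.
by rewrite -det0; ring.
Qed.

(** A column has rank at most 1, and rank 0 when it is zero. The second alternative serves u = 0,
    where dimension 1 is allowed. *)
Lemma row_orthogonal (K : fieldType) (m : nat) (v : 'cV[K]_m) :
  (1 < m)%N || ((0 < m)%N && (v == 0)) ->
  exists2 y : 'rV[K]_m, y != 0 & y *m v = 0.
Proof.
move=> dim_m; have: kermx v != 0.
  rewrite kermx_eq0 /row_free neq_ltn; apply/orP; left.
  case/orP: dim_m => [lt1m|/andP[lt0m /eqP->]]; last by rewrite mxrank0.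
  exact: leq_ltn_trans (rank_leq_col v) lt1m.
by case/rowV0Pn => y /sub_kermxP yv0 y_neq0; exists y.
Qed.

(** * Matrices of the shape of G *)

Section NaturalMatrix.
Variables (K : fieldType) (m : nat) (S : 'M[K]_m) (u w : 'rV[K]_m).
Hypotheses (S_unit : S \in unitmx) (S_sym : S^T = S) (wE : w = u *m S).
Let t : K := (w *m u^T) 0 0.

(** Since S u^T = w^T, w S^-1 = u and w u^T = t, every product involving a rank-one term is a
    multiple of w^T u. *)
Lemma mul_metric_rank1 (a b c d : K) :
  (a *: S + b *: (w^T *m w)) *m (c *: invmx S + d *: (u^T *m u)) =
  (a * c)%:M + (a * d + b * c + b * d * t) *: (w^T *m u).
Proof.
have SuT : S *m u^T = w^T by rewrite wE trmx_mul S_sym.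
have wS : w *m invmx S = u by rewrite wE mulmxK.
have wu : w *m u^T = t%:M by rewrite [LHS]mx11_scalar.
rewrite mulmxDl !mulmxDr -!scalemxAl -!scalemxAr mulmxV // !mulmxA SuT.
rewrite -[w^T *m w *m invmx S]mulmxA wS -[w^T *m w *m u^T]mulmxA wu.
rewrite mul_mx_scalar -scalemxAl !scalerA scalemx1 -!addrA !scalerDl.
by rewrite mulrA.
Qed.

(** The matrix of G at (x, u), horizontal fields first: S is the matrix of g, w_i stands for g(∂_i,
    u), and the scalars are the values of the coefficients at t. *)
Definition natural_mx (a1 a2 a13 b1 b2 b13 : K) : 'M[K]_(m + m) :=
  block_mx (a13 *: S + b13 *: (w^T *m w)) (a2 *: S + b2 *: (w^T *m w))
           (a2 *: S + b2 *: (w^T *m w)) (a1 *: S + b1 *: (w^T *m w)).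

Variables (a1 a2 a13 b1 b2 b13 : K).
Let G := natural_mx a1 a2 a13 b1 b2 b13.
Let f1 := a1 + t * b1.
Let f2 := a2 + t * b2.
Let f13 := a13 + t * b13.

Lemma mul_row_natural_mx (y : 'rV[K]_m) (a b : K) :
  row_mx (a *: y) (b *: y) *m G =
  row_mx ((a * a13 + b * a2) *: (y *m S)
            + ((a * b13 + b * b2) * (y *m w^T) 0 0) *: w)
         ((a * a2 + b * a1) *: (y *m S)
            + ((a * b2 + b * b1) * (y *m w^T) 0 0) *: w).
Proof.
have yww : y *m (w^T *m w) = (y *m w^T) 0 0 *: w.
  by rewrite mulmxA [y *m w^T in LHS]mx11_scalar mul_scalar_mx.
rewrite mul_row_block !mulmxDr -!scalemxAl -!scalemxAr yww !scalerA !scalerDl.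
congr row_mx; rewrite addrACA -!scalerDl; congr (_ *: _ + _ *: _); ring.
Qed.

Hypothesis G_unit : G \in unitmx.

(** If G acts on the rows (a y, b y) through a symmetric 2x2 matrix, a kernel vector of the latter
    yields a nonzero row killed by G. *)
Lemma natural_mx_det_neq0 (y : 'rV[K]_m) (p q r : K) : y != 0 ->
  (forall a b, row_mx (a *: y) (b *: y) *m G =
     row_mx ((a * p + b * q) *: (y *m S)) ((a * q + b * r) *: (y *m S))) ->
  p * r - q ^+ 2 != 0.
Proof.
move=> y_neq0 mulyG; apply/eqP => /sym2_kernel[a [b [ab_neq0 ab1 ab2]]].
have : row_mx (a *: y) (b *: y) *m G = 0.
  by rewrite mulyG ab1 ab2 scale0r row_mx0.
move=> /(congr1 (mulmx^~ (invmx G))); rewrite mulmxK // mul0mx.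
move=> /eqP; rewrite row_mx_eq0 !scaler_eq0 (negbTE y_neq0) !orbF.
by case/andP=> a0 b0; rewrite a0 b0 in ab_neq0.
Qed.

Lemma natural_alpha_neq0 (y : 'rV[K]_m) :
  y != 0 -> y *m w^T = 0 -> a13 * a1 - a2 ^+ 2 != 0.
Proof.
move=> y_neq0 yw0; apply: natural_mx_det_neq0 y_neq0 _ => a b.
by rewrite mul_row_natural_mx yw0 mxE !mulr0 scale0r !addr0.
Qed.

Lemma natural_phi_neq0 : u != 0 -> f13 * f1 - f2 ^+ 2 != 0.
Proof.
move=> u_neq0; apply: natural_mx_det_neq0 u_neq0 _ => a b.
have ut : (u *m w^T) 0 0 = t by rewrite /t -[u in LHS]trmxK -trmx_mul mxE.
(* As w = u S, the two terms in each block merge, which turns each coefficient a into a + t b. *)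
rewrite mul_row_natural_mx ut -wE -!scalerDl.
by congr row_mx; congr (_ *: _); rewrite /f1 /f2 /f13; ring.
Qed.

End NaturalMatrix.

(** * Locality of differentiability and smoothness *)

Lemma near_eq_differentiable (R : realType) (V W : normedModType R)
    (f h : V -> W) (x : V) :
  (\near x, f x = h x) -> differentiable f x -> differentiable h x.
Proof.
move=> fh df; have fhx : f x = h x by exact: nbhs_singleton fh.
(* The first-order expansion of f is also one for h, because its remainder only concerns values near
   x; uniqueness of the differential then concludes. *)
have dh : h \o shift x = cst (h x) + 'd f x +o_ 0 id.
  apply/eqaddoP => _/posnumP[e].
  have /eqaddoP/(_ e%:num (ltac:(by []))) := diff_locally df.
  have : \forall y \near (0 : V), f (y + x) = h (y + x).
    by move: fh; rewrite (near_shift 0 x) subr0.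
  apply: filter_app2; near=> y => fhy.
  by rewrite /= !fctE /= fhy fhx.
apply/diff_locallyP; rewrite (diff_unique (diff_continuous df) dh).
by split=> //; exact: diff_continuous.
Unshelve. all: by end_near. Qed.

Lemma near_eq_diff (R : realType) (V W : normedModType R)
    (f h : V -> W) (x v : V) :
  (\near x, f x = h x) -> differentiable f x -> 'd f x v = 'd h x v.
Proof.
move=> fh df; rewrite -!deriveE //; first exact: near_eq_derive.
exact: near_eq_differentiable fh df.
Qed.

(** On an open D, agreement on D is agreement near each of its points, so the directional
    derivatives agree on D too and the induction passes to them. *)
Lemma Ck_ext (R : realType) (V W : normedModType R) (k : nat) (D : set V)
    (f h : V -> W) :
  open D -> {in D, f =1 h} -> Ck k D f -> Ck k D h.
Proof.
move=> D_open; elim: k f h => [|k IHk] f h fh.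
  move=> fc x Dx; have fhx : \near x, f x = h x.
    by near=> y; apply: fh; rewrite inE; near: y; exact: open_nbhs_nbhs.
  rewrite /prop_for /continuous_at -(nbhs_singleton fhx).
  by apply: cvg_trans (fc x Dx); exact: near_eq_cvg.
have fhx x : D x -> \near x, f x = h x.
  by move=> Dx; near=> y; apply: fh; rewrite inE; near: y; exact: open_nbhs_nbhs.
move=> [df Dkf]; split=> [x Dx|v].
  exact: near_eq_differentiable (fhx x Dx) (df x Dx).
by apply: IHk (Dkf v) => x; rewrite inE => Dx; apply: near_eq_derive; exact: fhx.
Unshelve. all: by end_near. Qed.

Lemma diff_coord (R : realType) (m : nat) (i : 'I_m) (x v : 'rV[R]_m) :
  'd (fun N : 'rV[R]_m => N 0 i : R^o) x v = v 0 i.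
Proof.
have coord_linear : linear (fun N : 'rV[R]_m => N 0 i : R^o).
  by move=> a X Y; rewrite !mxE.
pose coordM := GRing.isLinear.Build _ _ _ _ _ coord_linear.
pose coordL : {linear 'rV[R]_m -> R^o} :=
  HB.pack (fun N : 'rV[R]_m => N 0 i : R^o) coordM.
by rewrite (@diff_lin _ _ _ coordL) //; exact: coord_continuous.
Qed.

(** Taking a coordinate is linear, hence commutes with directional derivatives wherever f is
    differentiable. This is known on D only, so [Ck_ext] carries the induction. *)
Lemma smooth_on_coord (R : realType) (V : normedModType R) (m : nat)
    (D : set V) (f : V -> 'rV[R]_m) (i : 'I_m) :
  open D -> smooth_on D f -> smooth_on D (fun v => f v 0 i : R^o).
Proof.
move=> D_open smf k; elim: k f {smf}(smf k) => [|k IHk] f.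
  move=> fc x Dx.
  apply: (continuous_comp (g := fun N : 'rV[R]_m => N 0 i : R^o)).
    exact: fc.
  exact: coord_continuous.
move=> [df Dkf]; split=> [x Dx|v].
  apply: (differentiable_comp (g := fun N : 'rV[R]_m => N 0 i : R^o)).
    exact: df.
  exact: differentiable_coord.
apply: (Ck_ext D_open) (IHk _ (Dkf v)) => x; rewrite inE => Dx.
rewrite !deriveE; last exact: df.
- rewrite (diff_comp (g := fun N : 'rV[R]_m => N 0 i : R^o)) /=.
  + by rewrite diff_coord.
  + exact: df.
  + exact: differentiable_coord.
- apply: (differentiable_comp (g := fun N : 'rV[R]_m => N 0 i : R^o)).
    exact: df.
  exact: differentiable_coord.
Qed.

(** * Charts, changes of coordinates and coordinate fields *)

Lemma open_fwd_image (R : realType) (m : nat) (M : topologicalType)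
    (c : chart R m M) (V : set M) :
  is_chart c -> open V -> open (fwd c @` (dom c `&` V)).
Proof.
move=> [_ cod_open fwdK _ bwd_cont] V_open.
(* Rewritten as a preimage under [bwd c], the image is open by continuity of [bwd c] on the open set
   [cod c]. *)
have -> : fwd c @` (dom c `&` V) = cod c `&` bwd c @^-1` V.
  apply/seteqP; split=> [_ [y [cy Vy] <-]|_ [[y cy <-]]] /=.
    by split; [exists y|rewrite /= fwdK].
  by rewrite /= fwdK // => Vy; exists y.
rewrite openE => v [cv Vv]; apply: filterI; first exact: open_nbhs_nbhs.
by apply: bwd_cont => //; exact: open_nbhs_nbhs.
Qed.

Section ChartChange.
Variables (R : realType) (m : nat) (M : topologicalType).
Variable A : set (chart R m M).
Hypothesis smooth_A : smooth_manifold A.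

Lemma atlas_chart c : A c -> is_chart c.
Proof. by case: smooth_A => _ _ + _ _ _; apply. Qed.

Lemma bwd_near c x (V : set M) : A c -> dom c x -> open V -> V x ->
  \forall v \near fwd c x, V (bwd c v).
Proof.
move=> /atlas_chart[_ _ fwdK _ bwd_cont] cx V_open Vx.
apply: bwd_cont; first by exists x.
by rewrite fwdK //; exact: open_nbhs_nbhs.
Qed.

Lemma transition_differentiable c d x : A c -> A d -> dom c x -> dom d x ->
  differentiable (fwd d \o bwd c) (fwd c x).
Proof.
move=> Ac Ad cx dx; case: smooth_A => _ _ _ _ /(_ c d Ac Ad)[smcd _] _.
by have [df _] := smcd 1%N; apply: df; exists x.
Qed.

(** Chain rule for a change of chart. The composite through d agrees with [f \o bwd c] only near
    [fwd c x], so locality of the differential is needed as well. *)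
Lemma diff_transition (W : normedModType R) (f : M -> W) c d x v :
  A c -> A d -> dom c x -> dom d x ->
  differentiable (f \o bwd d) (fwd d x) ->
  'd (f \o bwd d) (fwd d x) ('d (fwd d \o bwd c) (fwd c x) v) =
  'd (f \o bwd c) (fwd c x) v.
Proof.
move=> Ac Ad cx dx df; have [_ _ cK _ _] := atlas_chart Ac.
have [d_open _ dK _ _] := atlas_chart Ad.
have fwdE : (fwd d \o bwd c) (fwd c x) = fwd d x by rewrite /= cK.
have df' : differentiable (f \o bwd d) ((fwd d \o bwd c) (fwd c x)).
  by rewrite fwdE.
have dfd := transition_differentiable Ac Ad cx dx.
have := congr1 (@^~ v) (diff_comp dfd df').
rewrite fwdE /= => dfE; rewrite -[LHS]dfE.
apply: near_eq_diff; last exact: differentiable_comp.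
near=> y; rewrite /= dK //; near: y; exact: bwd_near.
Unshelve. all: by end_near. Qed.

(** The transition from c to itself is the identity on the open set [cod c], so its differential is
    the identity. *)
Lemma of_coord_chart c x v : A c -> dom c x -> of_coord A c x v c = v.
Proof.
move=> Ac cx; rewrite /of_coord asboolT //.
have [c_open c_cod cK _ _] := atlas_chart Ac.
have idc : \forall y \near fwd c x, y = (fwd c \o bwd c) y.
  near=> y; have [z cz <-] : cod c y by near: y; apply: open_nbhs_nbhs; split=> //; exists x.
  by rewrite /= cK.
by rewrite -(near_eq_diff v idc) ?(diff_val (f := id)) //; exact: (ex_diff (f := id)).
Unshelve. all: by end_near. Qed.

Lemma of_coord_tangent c x v : A c -> dom c x -> tangent A x (of_coord A c x v).
Proof.
move=> Ac cx; split=> [d e Ad dx Ae ex|d Ndx]; last by rewrite /of_coord asboolF.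
rewrite /of_coord !asboolT //; apply/esym/(diff_transition (f := fwd e)) => //.
exact: transition_differentiable.
Qed.

Lemma chart_atP x : A (chart_at A x) /\ dom (chart_at A x) x.
Proof.
rewrite /chart_at; case: xgetP => [c _ []//|none].
by case: smooth_A => _ _ _ /(_ x)[c Ac cx] _ _; case: (none c).
Qed.

(** [vact] computes in an arbitrarily chosen chart; [diff_transition] moves the computation to c,
    where [fwd c y 0 j] reads as a linear coordinate. *)
Lemma vact_partial_coord c x i j : A c -> dom c x ->
  vact A x (partial A c x i) (fun y => fwd c y 0 j) = (i == j)%:R.
Proof.
move=> Ac cx; rewrite /vact; have [Ad dx] := chart_atP x.
set d := chart_at A x in Ad dx *.
rewrite /partial /of_coord asboolT //.
have dcoord : differentiable ((fun y => fwd c y 0 j : R^o) \o bwd d) (fwd d x).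
  apply: (differentiable_comp (f := fwd c \o bwd d)
    (g := fun N : 'rV[R]_m => N 0 j : R^o)).
    exact: transition_differentiable.
  exact: differentiable_coord.
rewrite (diff_transition _ Ac Ad cx dx dcoord).
have -> : (fun y => fwd c y 0 j : R^o) \o bwd c =
    (fun N : 'rV[R]_m => N 0 j : R^o) \o (fwd c \o bwd c) by [].
rewrite diff_comp /=; last 2 first.
- exact: transition_differentiable.
- exact: differentiable_coord.
rewrite diff_coord; have := of_coord_chart (delta_mx 0 i) Ac cx.
by rewrite /of_coord asboolT // => ->; rewrite mxE eqxx eq_sym.
Qed.

(** Makes the coordinate functions admissible as local test functions in [vlift]. *)
Lemma coord_smooth_fun c j : A c -> smooth_fun A (dom c) (fun y => fwd c y 0 j).
Proof.
move=> Ac d Ad; have [c_open _ _ _ _] := atlas_chart Ac.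
apply: (smooth_on_coord (f := fwd c \o bwd d)).
  exact: open_fwd_image (atlas_chart Ad) c_open.
by case: smooth_A => _ _ _ _ /(_ d c Ad Ac)[].
Qed.

End ChartChange.

(** * Linear algebra in tangent spaces *)

Section TangentSpace.
Variables (R : realType) (n : nat) (N : Type) (B : set (chart R n N)) (x : N).

Lemma tvec_combE k (e : 'I_k -> tvec R n N) (a : 'I_k -> R) (c : chart R n N) :
  (\sum_i a i *: e i) c = \sum_i a i *: e i c.
Proof. by rewrite fct_sumE. Qed.

Lemma tangent_comb k (e : 'I_k -> tvec R n N) (a : 'I_k -> R) :
  (forall i, tangent B x (e i)) -> tangent B x (\sum_i a i *: e i).
Proof.
move=> Te; split=> [c d Bc cx Bd dx|c Nc]; rewrite !tvec_combE; last first.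
  by rewrite big1 // => i _; case: (Te i) => _ ->; rewrite ?scaler0.
rewrite linear_sum; apply: eq_bigr => i _; rewrite linearZ /=; congr (_ *: _).
by case: (Te i) => + _; apply.
Qed.

(** The transformation law recovers the components in all charts around x from those in c, and the
    other components are 0 by convention. *)
Lemma tangent_inj X Y c :
  tangent B x X -> tangent B x Y -> B c -> dom c x -> X c = Y c -> X = Y.
Proof.
move=> [lawX X0] [lawY Y0] Bc cx XYc; apply/funext => d.
have [[Bd dx]|Nd] := pselect (B d /\ dom d x); last by rewrite X0 ?Y0.
by rewrite (lawX c d) // (lawY c d) // XYc.
Qed.

Lemma tangent0 : tangent B x 0.
Proof. by split=> // c d _ _ _ _; rewrite linear0. Qed.

Lemma bilinear_comb k (b : tvec R n N -> tvec R n N -> R)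
    (e : 'I_k -> tvec R n N) (a : 'I_k -> R) Z :
  bilinear_on (tangent B x) b -> (forall i, tangent B x (e i)) ->
  tangent B x Z ->
  b (\sum_i a i *: e i) Z = \sum_i a i * b (e i) Z /\
  b Z (\sum_i a i *: e i) = \sum_i a i * b Z (e i).
Proof.
move=> [bl br] Te TZ; have T0 := tangent0.
(* The empty sum needs vanishing at 0, which follows by applying additivity to 0 = 1 · 0 + 0. *)
have b0Z : b 0 Z = 0.
  have := bl 1 0 0 Z T0 T0 TZ; rewrite scaler0 add0r mul1r.
  by rewrite -{1}[b 0 Z]addr0 => /addrI.
have bZ0 : b Z 0 = 0.
  have := br 1 0 0 Z T0 T0 TZ; rewrite scaler0 add0r mul1r.
  by rewrite -{1}[b Z 0]addr0 => /addrI.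
elim: k e a Te => [|k IHk] e a Te; first by rewrite !big_ord0.
rewrite !big_ord_recl.
have [ihl ihr] := IHk (e \o lift ord0) (a \o lift ord0) (fun i => Te _).
have TS : tangent B x (\sum_(i < k) a (lift ord0 i) *: e (lift ord0 i)).
  by apply: (tangent_comb (e := e \o lift ord0)) => i; exact: Te.
by rewrite bl // br // ihl ihr.
Qed.

(* Tangent vectors inject into R^n by their components in one chart, so n
   independent ones span the tangent space. *)
Lemma tangent_basis (e : 'I_n -> tvec R n N) (c : chart R n N) Z :
  B c -> dom c x -> (forall i, tangent B x (e i)) ->
  (forall a : 'I_n -> R, \sum_i a i *: e i = 0 -> forall i, a i = 0) ->
  tangent B x Z -> exists a : 'I_n -> R, Z = \sum_i a i *: e i.
Proof.
move=> Bc cx Te indep TZ; pose E := \matrix_i e i c.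
have mulE (v : 'rV_n) : v *m E = (\sum_i v 0 i *: e i) c.
  by rewrite mulmx_sum_row tvec_combE; apply: eq_bigr => i _; rewrite rowK.
have E_unit : E \in unitmx.
  rewrite -row_free_unit; apply: inj_row_free => v; rewrite mulE => vE0.
  apply/rowP => i; rewrite mxE; apply: (fun v0 => indep _ v0 i).
  by apply: (tangent_inj _ tangent0 Bc cx vE0); exact: tangent_comb.
exists (fun i => (Z c *m invmx E) 0 i); apply: (tangent_inj TZ _ Bc cx).
  exact: tangent_comb.
by rewrite -mulE mulmxKV.
Qed.

End TangentSpace.

(** * The closed form of the inverse *)

Section NaturalInverse.
Variables (R : realType) (F : coefs R) (m : nat) (S : 'M[R]_m) (u w : 'rV[R]_m).
Hypotheses (S_unit : S \in unitmx) (S_sym : S^T = S) (wE : w = u *m S).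
Let t := (w *m u^T) 0 0.
Hypotheses (alpha_neq0 : alpha F t != 0) (phi_neq0 : phi F t != 0).

Lemma natural_mx_inverse :
  natural_mx S w (al1 F t) (al2 F t) (al13 F t) (be1 F t) (be2 F t) (be13 F t)
  *m block_mx
    ((al1 F t / alpha F t) *: invmx S + (- psi_lambda F t) *: (u^T *m u))
    ((- (al2 F t / alpha F t)) *: invmx S + (- psi_theta F t) *: (u^T *m u))
    ((- (al2 F t / alpha F t)) *: invmx S + (- psi_theta F t) *: (u^T *m u))
    ((al13 F t / alpha F t) *: invmx S + (- psi_omega F t) *: (u^T *m u)) = 1%:M.
Proof.
rewrite mulmx_block !(mul_metric_rank1 S_unit S_sym wE) -/t scalar_mx_block.
(* Each block of the product reduces to two scalar identities: one for the coefficient of the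
   identity matrix, one for that of w^T u. *)
have addE (x1 x2 y1 y2 z : R) : x1 + x2 = z -> y1 + y2 = 0 ->
    (x1%:M + y1 *: (w^T *m u)) + (x2%:M + y2 *: (w^T *m u)) = (z%:M : 'M[R]_m).
  by move=> xz y0; rewrite addrACA -scalerDl y0 scale0r addr0 -raddfD xz.
move: alpha_neq0 phi_neq0.
rewrite /psi_lambda /psi_theta /psi_omega /phi /phi13 /phi1 /phi2 /phi3 /alpha.
rewrite /al13 /be13.
move: (al1 F t) (al2 F t) (al3 F t) (be1 F t) (be2 F t) (be3 F t) t.
move=> a1 a2 a3 b1 b2 b3 s al_neq0 ph_neq0.
(* The off-diagonal zero blocks become the scalar matrix of 0, so that [addE] covers all four
   blocks. *)
by congr block_mx; rewrite -?[RHS](raddf0 (@scalar_mx R m)); apply: addE;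
  field; rewrite al_neq0 ?ph_neq0.
Qed.

End NaturalInverse.

(** * Gram matrices of nondegenerate forms *)

Lemma gram_unit (R : realType) (n : nat) (N : Type) (B : set (chart R n N))
    (x : N) (c : chart R n N) (b : tvec R n N -> tvec R n N -> R)
    (e : 'I_n -> tvec R n N) :
  B c -> dom c x -> bilinear_on (tangent B x) b ->
  (forall W, tangent B x W -> (forall Z, tangent B x Z -> b W Z = 0) -> W = 0) ->
  (forall i, tangent B x (e i)) ->
  (forall a : 'I_n -> R, \sum_i a i *: e i = 0 -> forall i, a i = 0) ->
  \matrix_(i, j) b (e i) (e j) \in unitmx.
Proof.
move=> Bc cx bil nondeg Te indep; rewrite -row_free_unit.
(* A row v killing the matrix gives W = sum of v_i e_i orthogonal to every e_j. The e_j span, so W =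
   0 by nondegeneracy, and v = 0 by independence. *)
apply: inj_row_free => v /rowP vG0; apply/rowP => i; rewrite mxE.
apply: (fun v0 => indep _ v0 i); have TW := tangent_comb (v 0) Te.
apply: nondeg => // Z /(tangent_basis Bc cx Te indep)[z ->].
have [_ ->] := bilinear_comb z bil Te TW.
apply: big1 => j _; have [-> _] := bilinear_comb (v 0) bil Te (Te j).
have := vG0 j; rewrite !mxE => vGj0.
rewrite -[X in _ * X](_ : \sum_k v 0 k * (\matrix_(i, j) b (e i) (e j)) k j = _).
  by rewrite vGj0 mulr0.
by apply: eq_bigr => k _; rewrite mxE.
Qed.

Lemma vact_comb (R : realType) (n : nat) (N : Type) (B : set (chart R n N))
    (x : N) (f : N -> R) k (a : 'I_k -> R) (e : 'I_k -> tvec R n N) :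
  vact B x (\sum_i a i *: e i) f = \sum_i a i * vact B x (e i) f.
Proof.
rewrite /vact tvec_combE linear_sum; apply: eq_bigr => i _.
by rewrite linearZ.
Qed.

(** * The frame of horizontal and vertical lifts *)

Section LiftFrame.
Variables (R : realType) (m : nat) (M : topologicalType).
Variables (A : set (chart R m M)) (g : M -> tvec R m M -> tvec R m M -> R).
Variable nabla : (M -> tvec R m M) -> (M -> tvec R m M) -> M -> tvec R m M.
Variables (c : chart R m M) (x : M) (u : tvec R m M).
Hypotheses (smooth_A : smooth_manifold A) (Ac : A c) (cx : dom c x).

Lemma partial_tangent i : tangent A x (partial A c x i).
Proof. exact: of_coord_tangent. Qed.

Lemma partial_indep (a : 'I_m -> R) :
  \sum_i a i *: partial A c x i = 0 -> forall i, a i = 0.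
Proof.
move=> /(congr1 (@^~ c)) /=; rewrite tvec_combE => /rowP a0 j.
have := a0 j; rewrite summxE (bigD1 j) //= big1 => [|i neq_ij].
  by rewrite addr0 /partial of_coord_chart // !mxE !eqxx mulr1.
by rewrite /partial of_coord_chart // !mxE eqxx eq_sym (negbTE neq_ij) mulr0.
Qed.

Lemma metric_mx_unit : riemannian_metric A g -> metric_mx A g c x \in unitmx.
Proof.
move=> [bil sym pos _]; apply: (gram_unit Ac cx (bil x)) => [W TW W0|i|].
(* Positivity gives nondegeneracy on taking Z = W. *)
- by apply/eqP/negP => /negP /(pos _ _ TW); rewrite W0 ?ltxx.
- exact: partial_tangent.
- exact: partial_indep.
Qed.

Variables eh ev : 'I_m -> tbvec R m M.
Hypotheses (Tu : tangent A x u)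
  (ehP : forall i, hlift A nabla (x, u) (partial A c x i) (eh i))
  (evP : forall i, vlift A (x, u) (partial A c x i) (ev i)).

(** A single family indexed by ['I_(m + m)], the dimension of the bundle, as [gram_unit] requires;
    the order matches the blocks of [frame_mx]. *)
Definition lift_frame (k : 'I_(m + m)) : tbvec R m M :=
  match fintype.split k with inl i => eh i | inr i => ev i end.

Lemma lift_frame_tangent k : TTM A (x, u) (lift_frame k).
Proof.
rewrite /lift_frame; case: (fintype.split k) => i; first by case: (ehP i).
by case: (evP i) => [[]].
Qed.

Lemma lift_frame_indep (a : 'I_(m + m) -> R) :
  \sum_k a k *: lift_frame k = 0 -> forall k, a k = 0.
Proof.
pose a1 i := a (lshift m i); pose a2 i := a (rshift m i).
have -> : \sum_k a k *: lift_frame k =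
    \sum_i a1 i *: eh i + \sum_i a2 i *: ev i.
  rewrite big_split_ord /=; congr (_ + _); apply: eq_bigr => i _.
    by rewrite /lift_frame -[lshift _ _]/(unsplit (inl i)) unsplitK.
  by rewrite /lift_frame -[rshift _ _]/(unsplit (inr i)) unsplitK.
move=> sum0.
have tbc : tb_atlas A (tb_chart A c) by exists c.
have dtb : dom (tb_chart A c) (x, u) by [].
(* L is the projection differential in coordinates: it sends the horizontal lifts to the unit
   vectors and kills the vertical ones. *)
pose L := 'd (fwd c \o fst \o bwd (tb_chart A c)) (fwd (tb_chart A c) (x, u)).
have Leh i : L (eh i (tb_chart A c)) = delta_mx 0 i.
  case: (ehP i) => _ _ [_ /(_ _ c tbc dtb Ac cx) /esym].
  by rewrite /partial of_coord_chart.
have Lev i : L (ev i (tb_chart A c)) = 0.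
  by case: (evP i) => [[_ [_ /(_ _ c tbc dtb Ac cx) /esym]]].
have a1_0 i : a1 i = 0.
  have := congr1 (fun W => L (W (tb_chart A c))) sum0.
  rewrite -[LHS]/(L ((\sum_i a1 i *: eh i) (tb_chart A c)
                     + (\sum_i a2 i *: ev i) (tb_chart A c))).
  rewrite linearD !tvec_combE !linear_sum /= [X in _ + X]big1 => [|j _]; last first.
    by rewrite linearZ /= Lev scaler0.
  rewrite linear0 addr0 => /rowP/(_ i).
  under eq_bigr do rewrite linearZ /= Leh.
  rewrite summxE (bigD1 i) //= big1 => [|j neq_ji].
    by rewrite addr0 !mxE !eqxx mulr1.
  by rewrite !mxE eqxx eq_sym (negbTE neq_ji) mulr0.
have a2_0 i : a2 i = 0.
  move: sum0; rewrite big1 ?add0r => [sum0|j _]; last by rewrite a1_0 scale0r.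
  have [c_open _ _ _ _] := atlas_chart smooth_A Ac.
  (* With the horizontal part gone, the sum is applied to the function dx^i on the bundle; by the
     defining property of vertical lifts it returns the i-th coefficient. *)
  have := vact_comb (tb_atlas A) (x, u)
    (fun q => vact A q.1 q.2 (fun y => fwd c y 0 i)) a2 ev.
  rewrite sum0 (bigD1 i) //= big1 => [|j neq_ji].
    case: (evP i) => _ /(_ (dom c)) -> //; last exact: coord_smooth_fun.
    rewrite vact_partial_coord // eqxx mulr1 addr0 => <-.
    by rewrite /vact linear0.
  case: (evP j) => _ /(_ (dom c)) -> //; last exact: coord_smooth_fun.
  by rewrite vact_partial_coord // (negbTE neq_ji) mulr0.
by move=> k; case: (split_ordP k) => i ->; [exact: a1_0|exact: a2_0].
Qed.

Lemma frame_mx_unit (b : tbvec R m M -> tbvec R m M -> R) :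
  bilinear_on (TTM A (x, u)) b ->
  (forall W, TTM A (x, u) W ->
     (forall Z, TTM A (x, u) Z -> b W Z = 0) -> W = 0) ->
  frame_mx b eh ev \in unitmx.
Proof.
move=> bil nondeg.
have -> : frame_mx b eh ev = \matrix_(i, j) b (lift_frame i) (lift_frame j).
  have lfl i : lift_frame (lshift m i) = eh i.
    by rewrite /lift_frame -[lshift _ _]/(unsplit (inl i)) unsplitK.
  have lfr i : lift_frame (rshift m i) = ev i.
    by rewrite /lift_frame -[rshift _ _]/(unsplit (inr i)) unsplitK.
  apply/matrixP => i j; case: (split_ordP i) => i' ->; case: (split_ordP j) => j' ->;
  by rewrite ?block_mxEul ?block_mxEur ?block_mxEdl ?block_mxEdr !mxE ?lfl ?lfr.
apply: (gram_unit (c := tb_chart A c) _ _ bil nondeg).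
- by exists c.
- by [].
- exact: lift_frame_tangent.
- exact: lift_frame_indep.
Qed.

End LiftFrame.

(** * The inverse of G at a point of the tangent bundle *)

Theorem proposition2p2 (R : realType) (m : nat) (M : topologicalType)
    (A : set (chart R m M)) (g : M -> tvec R m M -> tvec R m M -> R)
    (nabla : (M -> tvec R m M) -> (M -> tvec R m M) -> M -> tvec R m M)
    (F : coefs R) (G : tbpoint R m M -> tbvec R m M -> tbvec R m M -> R)
    (p : M) (c : chart R m M) :
  smooth_manifold A -> riemannian_metric A g -> levi_civita A g nabla ->
  g_natural A g nabla F G -> nondegenerate_tb A G ->
  normal_coordinates A g nabla p c ->
  forall (x : M) (u : tvec R m M) (u_ : 'I_m -> R)
    (eh ev : 'I_m -> tbvec R m M),
  dom c x -> tangent A x u -> u = \sum_i u_ i *: partial A c x i ->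
  (forall i, hlift A nabla (x, u) (partial A c x i) (eh i)) ->
  (forall i, vlift A (x, u) (partial A c x i) (ev i)) ->
  let t := g x u u in
  let ginv := invmx (metric_mx A g c x) in
  let Gmx := frame_mx (G (x, u)) eh ev in
  Gmx \in unitmx /\
  exists Lambda Theta Omega : 'M[R]_m,
    invmx Gmx = block_mx Lambda Theta Theta Omega /\
    forall i j : 'I_m,
    [/\ Lambda i j =
          al1 F t / alpha F t * ginv i j - psi_lambda F t * u_ i * u_ j,
        Theta i j =
          - (al2 F t / alpha F t) * ginv i j - psi_theta F t * u_ i * u_ j &
        Omega i j =
          al13 F t / alpha F t * ginv i j - psi_omega F t * u_ i * u_ j].
Proof.
move=> smooth_A riem_g _ natG nondegG [Ac _ _ _ _] x u u_ eh ev cx Tu uE ehP evP.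
move=> t ginv Gmx.
case: (riem_g) => bil sym pos _.
case: natG => _ _ be0 bilG _ formG.
have Tp := @partial_tangent _ _ _ _ c x smooth_A Ac cx.
set S := metric_mx A g c x.
pose ur := \row_i u_ i; have [w wE] : exists w, w = ur *m S by exists (ur *m S).
have S_unit : S \in unitmx by exact: metric_mx_unit.
have S_sym : S^T = S by apply/matrixP => i j; rewrite !mxE sym.
have wgE i : g x (partial A c x i) u = w 0 i.
  rewrite sym // uE; have [-> _] := bilinear_comb u_ (bil x) Tp (Tp i).
  by rewrite wE mxE; apply: eq_bigr => k _; rewrite !mxE.
have tE : t = (w *m ur^T) 0 0.
  rewrite /t [X in g x _ X]uE; have [_ ->] := bilinear_comb u_ (bil x) Tp Tu.
  by rewrite mxE; apply: eq_bigr => k _; rewrite sym // wgE !mxE mulrC.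
have G_unit : Gmx \in unitmx.
  apply: (frame_mx_unit smooth_A Ac cx Tu ehP evP) => //; first exact: bilG.
  exact: nondegG.
(* In dimension 1 the β_i are known to vanish only for nonnegative arguments. *)
have t_ge0 : 0 <= t.
  have [u0|u_neq0] := eqVneq u 0; last exact/ltW/pos.
  have ur0 : ur = 0.
    by apply/rowP => i; rewrite !mxE; apply: (partial_indep smooth_A Ac cx); rewrite -uE.
  by rewrite tE ur0 trmx0 mulmx0 mxE.
have GE : Gmx = natural_mx S w (al1 F t) (al2 F t) (al13 F t)
    (be1 F t) (be2 F t) (be13 F t).
  congr block_mx; apply/matrixP => i j;
    have [hh hv vh vv] := formG _ _ _ _ _ _ _ _ Tu (Tp i) (Tp j) (ehP i) (evP i) (ehP j) (evP j);
    by rewrite !mxE big_ord1 !mxE ?hh ?hv ?vh ?vv !wgE mulrA.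
(* In dimension 0 there is no nonzero row to test α and φ with, but all matrices involved are
   empty. *)
have [m0|m_gt0] := posnP m.
  have noI (i : 'I_m) : False by case: i => i; rewrite m0.
  split=> //; exists 0, 0, 0; split=> [|i]; last by case: (noI i).
  by apply/matrixP => i; case: (split_ordP i) => k; case: (noI k).
have nat_unit := G_unit; rewrite GE in nat_unit.
have alpha_phi : alpha F t != 0 /\ phi F t != 0.
  have alphaE : alpha F t = al13 F t * al1 F t - al2 F t ^+ 2.
    by rewrite /alpha mulrC.
  have phi_alpha : t * be1 F t = 0 -> t * be2 F t = 0 -> t * be3 F t = 0 ->
      phi F t = alpha F t.
    by rewrite /phi /phi13 /phi1 /phi2 /phi3 => -> -> ->; rewrite !addr0.
  have alpha_neq0 (y : 'rV_m) : y != 0 -> y *m w^T = 0 -> alpha F t != 0.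
    by move=> y_neq0 yw0; rewrite alphaE (natural_alpha_neq0 nat_unit y_neq0 yw0).
  (* For u = 0 both t and w vanish, so any nonzero row is orthogonal to u and φ = α at t = 0. *)
  have [ur0|ur_neq0] := eqVneq ur 0.
    have w0 : w = 0 by rewrite wE ur0 mul0mx.
    have t0 : t = 0 by rewrite tE w0 mul0mx mxE.
    have [|y y_neq0 yw0] := @row_orthogonal _ _ w^T.
      by rewrite m_gt0 w0 trmx0 eqxx orbT.
    have -> : phi F t = alpha F t by apply: phi_alpha; rewrite t0 mul0r.
    by split; exact: alpha_neq0 yw0.
  have phi_neq0 : phi F t != 0.
    have := natural_phi_neq0 wE nat_unit ur_neq0; rewrite -tE.
    congr (_ != 0); rewrite /phi /phi13 /phi1 /phi2 /phi3 /al13 /be13; ring.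
  split=> //; have [m_gt1|m_le1] := ltnP 1 m.
    have [|y y_neq0 yw0] := @row_orthogonal _ _ w^T; first by rewrite m_gt1.
    exact: alpha_neq0 yw0.
  have m1 : m = 1%N by apply/eqP; rewrite eqn_leq m_le1.
  have [b1 b2 b3] := be0 m1 t t_ge0.
  by rewrite -phi_alpha // ?b1 ?b2 ?b3 mulr0.
have [alpha_neq0 phi_neq0] := alpha_phi.
have := natural_mx_inverse (F := F) S_unit S_sym wE.
rewrite -tE -GE => /(_ alpha_neq0 phi_neq0) GV.
(* The blocks are left open, then filled by unification with the explicit right inverse in [GV],
   which equals [invmx Gmx] because [Gmx] is invertible. *)
split=> //; do 3!eexists; split.
  by rewrite -[LHS]mulmx1 -GV mulKmx.
have urE i j : (ur^T *m ur) i j = u_ i * u_ j by rewrite mxE big_ord1 !mxE.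
by move=> i j; split; rewrite mxE [X in X + _]mxE [X in _ + X]mxE urE !mulNr mulrA.
Qed.
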